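(* For $i,j,n\ge 0$ let $q(i,j,n)$ be the number of walks with $n$ steps, each in $\{(1,0),(-1,0),(0,1),(0,-1)\}$, that start at $(0,0)$, end at $(i,j)$, and stay in the quarter plane $\mathbb{Z}_+^2=\{0,1,2,\dots\}^2$, and let $Q(0,0,z)=\sum_{n\ge 0} q(0,0,n)z^n$. Then for every real $z$ with $0<z<1/4$, $$Q(0,0,z)=\frac{1}{\pi}\int_{-1}^{1}\frac{1-2uz-\sqrt{(1-2uz)^2-4z^2}}{z^2}\,\sqrt{1-u^2}\,\mathrm{d}u .$$
   Context: The series converges for $|z|<1/4$ since $q(i,j,n)\le 4^n$. For $0<z<1/4$ and $u\in[-1,1]$ the quantity under the square root is positive, and the square root is the positive one. *)

(* Defs.v *)
From mathcomp Require Import all_boot all_order all_algebra.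
From Stdlib Require Import Reals.
From Coquelicot Require Import Coquelicot.

Set Implicit Arguments.
Unset Strict Implicit.
Unset Printing Implicit Defensive.

Local Open Scope ring_scope.

Definition steps : seq (int * int) := [:: (1, 0); (- 1, 0); (0, 1); (0, - 1)].

(* A walk from (0,0) is encoded by the tuple of its steps; [seq_sub steps] is
   the finite type of the elements of [steps]. *)
Definition position (n : nat) (w : n.-tuple (seq_sub steps)) (k : nat) : int * int :=
  \sum_(s <- take k w) ssval s.

Definition in_quarter_plane (p : int * int) : bool := (0 <= p.1) && (0 <= p.2).

Definition q (i j n : nat) : nat :=
  #|[set w : n.-tuple (seq_sub steps) |
      [forall k : 'I_n.+1, in_quarter_plane (position w k)]
      && (position w n == (Posz i, Posz j))]|.

Definition Q00 (z : R) : R := PSeries (fun n : nat => INR (q 0 0 n)) z.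

(* Main.v *)
(** Let [step_sum F (i, j)] be the sum of [F] over the neighbours of [(i, j)] in
    the quarter plane, so that [q(0,0,n)] is the value at the origin of the
    [n]-th iterate of [step_sum] on the indicator of the origin.  Write [U_i]
    for the Chebyshev polynomials of the second kind; [2u U_i = U_{i+1} + U_{i-1}]
    with [U_{-1} = 0] matches horizontal steps and [int U_i(u) sqrt(1-u^2) du]
    is [PI/2] for [i = 0] and [0] otherwise.  Hence, if [E(i,j) = U_i(u) [j = 0]],
    then [q(0,0,n)] is [2/PI] times the integral against [sqrt(1-u^2)] of
    [step_sum^n E (0,0)].

    For fixed [u], let [r] be the small root of [z (2u + r + 1/r) = 1] and
    [F(i,j) = U_i(u) r^j].  The kernel method gives [step_sum F = F/z - E/r], so
    [sum_{n<N} z^n step_sum^n E (0,0)] telescopes to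
    [(r/z) (1 - z^N step_sum^N F (0,0))].  As [|F(i,j)| <= i+1] and
    [step_sum (i+1) <= 4 (i+1)], the error is at most [(4z)^N / z], uniformly in
    [u], and the series can be integrated termwise; [2 r/z] is the first
    factor of the integrand. *)
Require Import Defs.
From Stdlib Require Import Reals Lra.
From Coquelicot Require Import Coquelicot.
From mathcomp Require Import all_boot all_order all_algebra.
Import GRing.Theory.

(** * Walks from a point to the origin, and their recurrence on the first step *)

Section Excursions.
Local Open Scope ring_scope.

(** The start [p] varies while the end is fixed at the origin, so that deleting the first step
    leaves a condition of the same form. *)
Fixpoint excursion (p : int * int) (w : seq (seq_sub steps)) : bool :=
  in_quarter_plane p &&
  (if w is s :: w' then excursion (p + ssval s) w' else p == (0, 0)).

Lemma excursionE n (w : n.-tuple (seq_sub steps)) (p : int * int) :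
  [forall k : 'I_n.+1, in_quarter_plane (p + position w k)]
    && (p + position w n == (0, 0)) = excursion p w.
Proof.
rewrite /position; elim: n w p => [|n IHn] w p.
  rewrite (tuple0 w) /= !big_nil !addr0; congr (_ && _).
  apply/forallP/idP => [/(_ ord0)|H k]; by rewrite ?big_nil ?addr0.
case/tupleP: w => s w; rewrite [RHS]/= -(IHn w) /= big_cons !addrA andbA.
congr (_ && _).
apply/forallP/andP => [H | [Hp /forallP H] k].
  split; first by move: (H ord0); rewrite /= big_nil addr0.
  apply/forallP => k; move: (H (lift ord0 k)).
  by rewrite /= big_cons addrA.
case: (unliftP ord0 k) => [k'|] ->; last by rewrite /= big_nil addr0.
by rewrite /= big_cons addrA; apply: H.
Qed.

Definition excursions (p : int * int) (n : nat) : nat :=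
  (\sum_(w : n.-tuple (seq_sub steps)) nat_of_bool (excursion p w))%N.

Lemma q_excursions n : q 0 0 n = excursions (0, 0) n.
Proof.
rewrite /q /excursions -sum1_card big_mkcond; apply: eq_bigr => w _.
rewrite inE -excursionE add0r.
under eq_forallb => k do rewrite -[position w k]add0r.
by case: (_ && _).
Qed.

Lemma excursions0 p : excursions p 0 = (p == (0, 0)) :> nat.
Proof.
rewrite /excursions (bigD1 [tuple]) //= big1 => [|w]; last by case/eqP; apply: tuple0.
by case: eqP => [->|]; rewrite ?andbF.
Qed.

(** Justifies the default 0 that [step_sum] uses for neighbours outside the quarter plane. *)
Lemma excursions_out p n : ~~ in_quarter_plane p -> excursions p n = 0%N.
Proof.
move=> /negbTE Hp; apply: big1 => w _.
by case: (tval w) => [|s w'] /=; rewrite Hp.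
Qed.

Lemma excursionsS p n : in_quarter_plane p ->
  excursions p n.+1 = (\sum_(s <- steps) excursions (p + s)%R n)%N.
Proof.
move=> Hp.
transitivity (\sum_(s : seq_sub steps) excursions (p + ssval s)%R n)%N; last first.
  have Hu : uniq steps by [].
  rewrite -[in RHS](val_seq_sub_enum Hu) big_map.
  by rewrite /index_enum 3!unlock.
rewrite /excursions pair_big /= (reindex (fun sw : seq_sub steps * n.-tuple (seq_sub steps) =>
   [tuple of sw.1 :: sw.2])) /=.
  by apply: eq_bigr => -[s w] _ /=; rewrite Hp.
exists (fun w : n.+1.-tuple (seq_sub steps) => (thead w, [tuple of behead w])) => [[s w]|w] _ /=.
  by congr (_, _); apply: val_inj.
by case/tupleP: w => s w; apply: val_inj; rewrite /= theadE.
Qed.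

End Excursions.

(** * The neighbour-sum operator and its iterates *)

Open Scope R_scope.

Definition step_sum (F : nat -> nat -> R) (i j : nat) : R :=
  F i.+1 j + (if i is i'.+1 then F i' j else 0) +
  (F i j.+1 + (if j is j'.+1 then F i j' else 0)).

Definition at_origin (i j : nat) : R :=
  if i is 0%N then if j is 0%N then 1 else 0 else 0.

Lemma INR_excursions n i j :
  INR (excursions (Posz i, Posz j) n) = Nat.iter n step_sum at_origin i j.
Proof.
elim: n i j => [|n IHn] i j; first by rewrite excursions0; case: i; case: j.
rewrite excursionsS // !big_cons big_nil addn0 /= /step_sum -!IHn.
have addE (a b c d : int) : ((a, b) + (c, d))%R = ((a + c)%R, (b + d)%R) by [].
rewrite !addE !addr0 -!PoszD !addn1 !plus_INR Rplus_assoc.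
congr (_ + (_ + (_ + _))).
- case: i => [|i]; first by rewrite excursions_out.
  by rewrite intS addrC addKr IHn.
- case: j => [|j]; first by rewrite excursions_out.
  by rewrite intS (addrC (1 : int)%R) addrK IHn.
Qed.

Lemma step_sumE (F : nat -> nat -> R) i j : step_sum F i j =
  F i.+1 j + (if i is i'.+1 then F i' j else 0) +
  (F i j.+1 + (if j is j'.+1 then F i j' else 0)).
Proof. by []. Qed.

Lemma iter_step_sum_ext (F G : nat -> nat -> R) n :
  (forall i j, F i j = G i j) ->
  forall i j, Nat.iter n step_sum F i j = Nat.iter n step_sum G i j.
Proof.
move=> FG; elim: n => [|n IHn] i j //=; rewrite !step_sumE !IHn.
by case: i => [|i]; case: j => [|j]; rewrite ?IHn.
Qed.

Lemma iter_step_sum_lin (F G : nat -> nat -> R) a b n i j :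
  Nat.iter n step_sum (fun i j => a * F i j + b * G i j) i j =
  a * Nat.iter n step_sum F i j + b * Nat.iter n step_sum G i j.
Proof.
elim: n i j => [|n IHn] i j //=; rewrite !step_sumE !IHn.
by case: i => [|i]; case: j => [|j]; rewrite ?IHn; ring.
Qed.

Lemma iter_step_sum_bound (F : nat -> nat -> R) n i j :
  (forall i j, Rabs (F i j) <= INR i.+1) ->
  Rabs (Nat.iter n step_sum F i j) <= 4 ^ n * INR i.+1.
Proof.
move=> HF; elim: n i j => [|n IHn] i j; first by rewrite /= Rmult_1_l.
have H4 : 0 < 4 ^ n by apply: pow_lt; lra.
rewrite [4 ^ _]/= [Nat.iter _ _ _]/= step_sumE.
apply: Rle_trans (Rabs_triang _ _) _.
have h1 := Rabs_triang (Nat.iter n step_sum F i.+1 j)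
  (if i is i'.+1 then Nat.iter n step_sum F i' j else 0).
have h2 := Rabs_triang (Nat.iter n step_sum F i j.+1)
  (if j is j'.+1 then Nat.iter n step_sum F i j' else 0).
have b1 := IHn i.+1 j; have b2 := IHn i j.+1.
(* The neighbours have weights [i+2], [i], [i+1], [i+1], with total [4(i+1)]. The bound for the left
   one survives at [i = 0], where the missing term and its weight both vanish. *)
have b3 : Rabs (if i is i'.+1 then Nat.iter n step_sum F i' j else 0)
   <= 4 ^ n * INR i.
  case: (i) => [|i'] //; rewrite Rabs_R0 /=; lra.
have b4 : Rabs (if j is j'.+1 then Nat.iter n step_sum F i j' else 0)
   <= 4 ^ n * INR i.+1.
  case: (j) => [|j'] //; rewrite Rabs_R0; apply: Rmult_le_pos; [lra|exact: pos_INR].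
rewrite !S_INR in b1 b2 b3 b4 *.
move: (4 ^ n) b1 b2 b3 b4 => x b1 b2 b3 b4; lra.
Qed.

Lemma is_RInt_step_sum (F : R -> nat -> nat -> R) (s : R -> R) a b G n :
  (forall i j, is_RInt (fun u => F u i j * s u) a b (G i j)) ->
  forall i j, is_RInt (fun u => Nat.iter n step_sum (F u) i j * s u) a b
    (Nat.iter n step_sum G i j).
Proof.
move=> HF; elim: n => [|n IHn] //= i j.
have H0 : is_RInt (fun u => 0 * s u) a b 0.
  apply: (is_RInt_ext (fun _ => 0)) => [x _|]; first by rewrite Rmult_0_l.
  have := is_RInt_const a b (0 : R); rewrite /scal /= /mult /= Rmult_0_r; exact.
apply: (is_RInt_ext (fun u => plus
  (plus (Nat.iter n step_sum (F u) i.+1 j * s u)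
        ((if i is i'.+1 then Nat.iter n step_sum (F u) i' j else 0) * s u))
  (plus (Nat.iter n step_sum (F u) i j.+1 * s u)
        ((if j is j'.+1 then Nat.iter n step_sum (F u) i j' else 0) * s u)))).
  by move=> x _; rewrite step_sumE /plus /=; ring.
apply: is_RInt_plus; apply: is_RInt_plus; try exact: IHn.
- by case: i.
- by case: j.
Qed.

(** * Chebyshev polynomials: recurrence, orthogonality to [U_0], and bound *)

(* [cheb_pair u i] is [(U_{i-1}(u), U_i(u))], with [U_{-1} = 0]. *)
Fixpoint cheb_pair (u : R) (i : nat) : R * R :=
  if i is i'.+1 then
    let: (a, b) := cheb_pair u i' in (b, 2 * u * b - a)
  else (0, 1).

Definition chebU (i : nat) (u : R) : R := (cheb_pair u i).2.

Lemma chebU0 u : chebU 0 u = 1.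
Proof. by []. Qed.

(** The three-term recurrence, shaped like the horizontal half of [step_sum] with the same default
    at [i = 0]. *)
Lemma chebUS i u :
  chebU i.+1 u + (if i is i'.+1 then chebU i' u else 0) = 2 * u * chebU i u.
Proof.
case: i => [|i]; rewrite /chebU /=; first ring.
case: (cheb_pair u i) => a b /=; ring.
Qed.

(** By the addition formulas for [(k+1)t + t] and [(k+1)t - t], both sides satisfy the same two-term
    recurrence. *)
Lemma chebU_cos i t : chebU i (cos t) * sin t = sin (INR i.+1 * t).
Proof.
have H k : sin (INR k.+2 * t) = 2 * cos t * sin (INR k.+1 * t) - sin (INR k * t).
  rewrite (_ : INR k.+2 * t = INR k.+1 * t + t); last by rewrite (S_INR k.+1); ring.
  rewrite (_ : INR k * t = INR k.+1 * t - t); last by rewrite (S_INR k); ring.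
  by rewrite sin_plus sin_minus; ring.
suff : chebU i (cos t) * sin t = sin (INR i.+1 * t) /\
       chebU i.+1 (cos t) * sin t = sin (INR i.+2 * t) by case.
elim: i => [|i [IH1 IH2]].
  have := chebUS 0 (cos t).
  rewrite !H chebU0 /= !Rmult_0_l !Rmult_1_l sin_0 Rplus_0_r => ->; split; ring.
split=> //; rewrite H -IH1 -IH2.
have := chebUS i.+1 (cos t) => /= h.
by rewrite -(Rplus_0_r (chebU i.+2 _)) -(Rplus_opp_r (chebU i (cos t))) -Rplus_assoc h; ring.
Qed.

Lemma chebU_continuous i u : continuous (chebU i) u.
Proof.
suff : continuous (chebU i) u /\ continuous (chebU i.+1) u by case.
elim: i => [|i [IH1 IH2]].
  split; first exact: continuous_const.
  apply: (continuous_ext (fun u => 2 * u)) => [x|].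
    by have := chebUS 0 x; rewrite chebU0; lra.
  by apply: ex_derive_continuous; auto_derive.
split=> //.
apply: (continuous_ext (fun u => minus (mult (2 * u) (chebU i.+1 u)) (chebU i u))).
  move=> x; have h : chebU i.+2 x + chebU i x = 2 * x * chebU i.+1 x := chebUS i.+1 x.
  change (2 * x * chebU i.+1 x - chebU i x = chebU i.+2 x); lra.
apply: continuous_minus => //; apply: continuous_mult => //.
by apply: ex_derive_continuous; auto_derive.
Qed.

Lemma is_RInt_sin_sin i :
  is_RInt (fun t => sin (INR i.+1 * t) * sin t) 0 PI (PI / 2 * at_origin i 0).
Proof.
have cont x : continuous (fun t => sin (INR i.+1 * t) * sin t) x.
  by apply: ex_derive_continuous; auto_derive.
case: i cont => [|i] cont.
  have -> : PI / 2 * at_origin 0 0 = (PI / 2 - sin (2 * PI) / 4) - (0 / 2 - sin (2 * 0) / 4).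
    by rewrite /at_origin sin_2PI Rmult_0_r sin_0; field.
  apply: (is_RInt_derive (fun t => t / 2 - sin (2 * t) / 4)) => x _ //.
  auto_derive => //; rewrite /= !Rmult_1_l cos_2a_sin; field.
pose k := INR i.+1; have k0 : 0 < k by apply: lt_0_INR; apply/ltP.
have sinPI n : sin (INR n * PI) = 0 by rewrite sin_eq_0_1 //; exists (Z.of_nat n); rewrite INR_IZR_INZ.
(* Antiderivative read off from [sin((k+1)t) sin t = (cos(kt) - cos((k+2)t)) / 2]; the division by
   [k] is why [i = 0] was treated apart. *)
pose F t := (sin (k * t) / k - sin (INR i.+3 * t) / INR i.+3) / 2.
have E2 : INR i.+2 = k + 1 by rewrite S_INR.
have E3 : INR i.+3 = k + 2 by rewrite S_INR E2; ring.
have -> : PI / 2 * at_origin i.+1 0 = F PI - F 0.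
  rewrite /F /at_origin !sinPI !Rmult_0_r sin_0.
  by rewrite E3; field; lra.
apply: (is_RInt_derive F) => x _ //.
rewrite /F E2 E3; auto_derive => //.
rewrite (_ : k * x = (k + 1) * x - x); last ring.
rewrite (_ : (k + 2) * x = (k + 1) * x + x); last ring.
by rewrite cos_minus cos_plus; field; lra.
Qed.

Lemma is_RInt_chebU i :
  is_RInt (fun u => chebU i u * sqrt (1 - u ^ 2)) (-1) 1 (PI / 2 * at_origin i 0).
Proof.
pose f u := chebU i u * sqrt (1 - u ^ 2).
(* [sqrt] is 0 on negative reals and continuous everywhere, so the endpoints need no special
   care. *)
have cf u : continuous f u.
  apply: continuous_mult; first exact: chebU_continuous.
  apply: (continuous_comp (fun u => 1 - u ^ 2)); last exact: continuous_sqrt.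
  by apply: ex_derive_continuous; auto_derive.
have exf : ex_RInt f (-1) 1 by apply: ex_RInt_continuous.
suff <- : RInt f (-1) 1 = PI / 2 * at_origin i 0 by exact: RInt_correct.
(* Substitution [u = cos t]: as [t] goes from 0 to [PI], [u] goes from 1 to -1, and this reversal
   cancels the sign of [- sin t]. *)
have sub := is_RInt_comp f cos (fun t => - sin t) 0 PI.
have {}sub : is_RInt (fun y => scal (- sin y) (f (cos y))) 0 PI (RInt f (cos 0) (cos PI)).
  apply: sub => // x _; split; first by auto_derive => //; ring.
  by apply: ex_derive_continuous; auto_derive.
rewrite cos_0 cos_PI -(opp_RInt_swap f) // in sub.
have {}sub := is_RInt_opp _ _ _ _ sub.
rewrite opp_opp in sub.
rewrite -(is_RInt_unique _ _ _ _ (is_RInt_sin_sin i)).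
rewrite -(is_RInt_unique _ _ _ _ sub).
have P0 := PI_RGT_0.
apply: RInt_ext => t; rewrite Rmin_left ?Rmax_right; [move=> Ht|lra|lra].
have s0 : 0 <= sin t by apply: sin_ge_0; lra.
change (- (- sin t * f (cos t)) = sin (INR i.+1 * t) * sin t).
rewrite /f -chebU_cos.
have -> : 1 - cos t ^ 2 = sin t * sin t.
  by have := sin2_cos2 t; rewrite /Rsqr; lra.
by rewrite sqrt_square //; ring.
Qed.

(** With [u = cos t], [U_{k+1} = cos t U_k + cos((k+1)t)], so the bound grows by at most 1 per
    index. *)
Lemma chebU_bound i u : -1 <= u <= 1 -> Rabs (chebU i u) <= INR i.+1.
Proof.
move=> /cos_acos <-; move: (acos u) => t.
(* Unlike [chebU_cos], this recurrence needs no division by [sin t] at the endpoints. *)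
have H k : chebU k.+1 (cos t) = cos t * chebU k (cos t) + cos (INR k.+1 * t).
  elim: k => [|k IHk].
    have -> : INR 1 * t = t by rewrite Rmult_1_l.
    by have := chebUS 0 (cos t); rewrite !chebU0; lra.
  have := chebUS k.+1 (cos t) => /= h.
  have c2 : cos (INR k.+2 * t) =
      cos (INR k.+1 * t) * cos t - chebU k (cos t) * (sin t * sin t).
    rewrite -Rmult_assoc chebU_cos S_INR.
    by rewrite (_ : (INR k.+1 + 1) * t = INR k.+1 * t + t) ?cos_plus; ring.
  have sc : sin t * sin t = 1 - cos t * cos t.
    by have := sin2_cos2 t; rewrite /Rsqr; lra.
  rewrite c2 sc; move: h; rewrite {}IHk => h.
  apply: (Rplus_eq_reg_r (chebU k (cos t))); rewrite h; ring.
elim: i => [|i IHi]; first by rewrite chebU0 Rabs_R1 /=; lra.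
rewrite H S_INR; apply: Rle_trans (Rabs_triang _ _) _.
have c1 x : Rabs (cos x) <= 1 by apply: Rabs_le; have := COS_bound x; lra.
rewrite Rabs_mult; apply: Rplus_le_compat (c1 _).
apply: Rle_trans IHi; rewrite -[X in _ <= X]Rmult_1_l.
by apply: Rmult_le_compat_r (c1 t); exact: Rabs_pos.
Qed.

(** * The kernel method at a fixed [u] *)

Section KernelMethod.
Variables (z u : R).
Hypotheses (z_gt0 : 0 < z) (z_lt : z < 1 / 4) (u_bound : -1 <= u <= 1).

Let disc := (1 - 2 * u * z) ^ 2 - 4 * z ^ 2.

Definition kernel_root : R := (1 - 2 * u * z - sqrt disc) / (2 * z).

Lemma disc_ge0 : 0 <= disc.
Proof.
have h : 0 <= (1 - 2 * u * z - 2 * z) * (1 - 2 * u * z + 2 * z) by apply: Rmult_le_pos; nra.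
rewrite /disc; lra.
Qed.

Lemma kernel_root_eq : z * (1 + 2 * u * kernel_root + kernel_root ^ 2) = kernel_root.
Proof.
have E : sqrt disc = 1 - 2 * u * z - 2 * z * kernel_root.
  by rewrite /kernel_root; field; lra.
have := sqrt_sqrt _ disc_ge0; rewrite E /disc => {}E.
apply: (Rmult_eq_reg_l (4 * z)); [lra | lra].
Qed.

Lemma kernel_root_bound : 0 < kernel_root <= 1.
Proof.
have E : sqrt disc = 1 - 2 * u * z - 2 * z * kernel_root.
  by rewrite /kernel_root; field; lra.
have s0 := sqrt_pos disc; have ss := sqrt_sqrt _ disc_ge0.
have w0 : 1 / 2 < 1 - 2 * u * z by nra.
have sw : sqrt disc < 1 - 2 * u * z.
  apply: Rsqr_incrst_0; rewrite /Rsqr; [|lra|lra].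
  by rewrite ss /disc; nra.
(* This is [kernel_root <= 1]. With [w = 1 - 2uz], it follows from
   [w^2 - 4z^2 - (w - 2z)^2 = 4z(w - 2z)] and [w > 1/2 > 2z]. *)
have ws : 1 - 2 * u * z - 2 * z <= sqrt disc.
  have [h|h] := Rle_lt_dec (1 - 2 * u * z - 2 * z) 0; first lra.
  apply: Rsqr_incr_0; rewrite /Rsqr; [|lra|lra].
  by rewrite ss /disc; nra.
split; [apply: (Rmult_lt_reg_l (2 * z)) | apply: (Rmult_le_reg_l (2 * z))]; lra.
Qed.

Definition full_gf (i j : nat) : R := chebU i u * kernel_root ^ j.
Definition axis_gf (i j : nat) : R := if j is 0%N then chebU i u else 0.

(** Horizontal steps multiply [full_gf] by [2u] and vertical ones by [r + 1/r], except that on the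
    row [j = 0] the downward term [U_i / r] is missing. *)
Lemma step_sum_full_gf i j :
  step_sum full_gf i j = / z * full_gf i j + - / kernel_root * axis_gf i j.
Proof.
have [r0 _] := kernel_root_bound; have re := kernel_root_eq.
set r := kernel_root in r0 re *.
have zE : / z = 2 * u + r + / r.
  have q0 : 0 < 1 + 2 * u * r + r ^ 2 by nra.
  by apply: (Rmult_eq_reg_l (z * r)); [field_simplify; [nra|lra|lra]|nra].
rewrite zE /step_sum /full_gf -/r.
have Ei := chebUS i u.
have -> : chebU i.+1 u * r ^ j + match i with 0%N => 0 | i'.+1 => chebU i' u * r ^ j end
   = 2 * u * chebU i u * r ^ j.
  by rewrite -Ei; case: (i) => [|i']; ring.
case: j => [|j] /=; field; lra.
Qed.

(** Write [T_n] for the iterates of [full_gf] at the origin. The previous identity makes the [n]-th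
    summand [(r/z) (z^n T_n - z^(n+1) T_(n+1))], and [T_0 = 1]. *)
Lemma axis_gf_partial_sum N :
  sum_n (fun n => z ^ n * Nat.iter n step_sum axis_gf 0%N 0%N) N =
  kernel_root / z * (1 - z ^ N.+1 * Nat.iter N.+1 step_sum full_gf 0%N 0%N).
Proof.
have [r0 _] := kernel_root_bound.
have iterE n : Nat.iter n.+1 step_sum full_gf 0%N 0%N =
   / z * Nat.iter n step_sum full_gf 0%N 0%N + - / kernel_root * Nat.iter n step_sum axis_gf 0%N 0%N.
  by rewrite Nat.iter_succ_r (iter_step_sum_ext _ _ _ step_sum_full_gf) iter_step_sum_lin.
elim: N => [|N IHN].
  rewrite sum_O iterE /= /full_gf chebU0 /=; field; lra.
rewrite sum_Sn IHN (iterE N.+1) /plus /= -/(Nat.iter _ _ _).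
field; lra.
Qed.

Lemma axis_gf_remainder N :
  Rabs (sum_n (fun n => z ^ n * Nat.iter n step_sum axis_gf 0%N 0%N) N - kernel_root / z)
    <= / z * (4 * z) ^ N.+1.
Proof.
have [r0 r1] := kernel_root_bound.
rewrite axis_gf_partial_sum.
have -> (x : R) : kernel_root / z * (1 - x) - kernel_root / z = - (kernel_root * / z * x).
  by field; lra.
have bd : Rabs (Nat.iter N.+1 step_sum full_gf 0%N 0%N) <= 4 ^ N.+1.
  (* The inserted factor 1 is the weight [i+1] at [i = 0]. *)
  rewrite -[4 ^ _]Rmult_1_r; apply: (iter_step_sum_bound _ _ 0%N) => i j.
  rewrite /full_gf Rabs_mult -[INR _]Rmult_1_r.
  apply: Rmult_le_compat; try exact: Rabs_pos.
    exact: chebU_bound.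
  rewrite -RPow_abs Rabs_pos_eq; last lra.
  by rewrite -(pow1 j); apply: pow_incr; lra.
have zi : 0 < / z by apply: Rinv_0_lt_compat.
have zn : 0 < z ^ N.+1 by apply: pow_lt.
have p4 : 0 < 4 ^ N.+1 by apply: pow_lt; lra.
rewrite Rpow_mult_distr.
move: (Nat.iter _ _ _ _ _) kernel_root (z ^ N.+1) (4 ^ N.+1) (/ z) bd r0 r1 zn p4 zi.
move=> T r x y w bd r0 r1 x0 y0 w0.
rewrite Rabs_Ropp !Rabs_mult !(Rabs_pos_eq r, Rabs_pos_eq w, Rabs_pos_eq x); try lra.
rewrite (Rmult_comm r) (Rmult_comm y) Rmult_assoc; apply: Rmult_le_compat_l; first lra.
rewrite -[X in _ <= X]Rmult_1_l.
have T0 := Rabs_pos T.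
apply: Rmult_le_compat; try lra; first by apply: Rmult_le_pos; lra.
by apply: Rmult_le_compat_l; lra.
Qed.

End KernelMethod.

(** * Termwise integration and passage to the limit *)

Lemma is_RInt_axis_gf n :
  is_RInt (fun u => Nat.iter n step_sum (axis_gf u) 0%N 0%N * sqrt (1 - u ^ 2))
    (-1) 1 (PI / 2 * INR (q 0 0 n)).
Proof.
(* The zero summand puts [PI / 2 * at_origin] in the form to which the linearity of the iterates
   applies. *)
have -> : PI / 2 * INR (q 0 0 n) =
    Nat.iter n step_sum (fun i j => PI / 2 * at_origin i j + 0 * at_origin i j) 0%N 0%N.
  by rewrite iter_step_sum_lin q_excursions INR_excursions; ring.
apply: is_RInt_step_sum => i j; rewrite Rmult_0_l Rplus_0_r.
case: j => [|j]; first exact: is_RInt_chebU.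
have -> : PI / 2 * at_origin i j.+1 = scal (1 - -1) 0.
  by rewrite /scal /= /mult /= /at_origin; case: i => [|i]; ring.
apply: (is_RInt_ext (fun _ => 0)) => [x _|]; first by rewrite /= Rmult_0_l.
exact: is_RInt_const.
Qed.

Lemma is_RInt_partial_sum z N :
  is_RInt (fun u => sum_n (fun n => z ^ n * Nat.iter n step_sum (axis_gf u) 0%N 0%N) N
                    * sqrt (1 - u ^ 2))
    (-1) 1 (PI / 2 * sum_n (fun n => INR (q 0 0 n) * z ^ n) N).
Proof.
have term n : is_RInt (fun u => z ^ n * Nat.iter n step_sum (axis_gf u) 0%N 0%N
    * sqrt (1 - u ^ 2)) (-1) 1 (PI / 2 * (INR (q 0 0 n) * z ^ n)).
  have -> : PI / 2 * (INR (q 0 0 n) * z ^ n) = scal (z ^ n) (PI / 2 * INR (q 0 0 n)).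
    by rewrite /scal /= /mult /=; ring.
  apply: is_RInt_ext (is_RInt_scal _ _ _ _ _ (is_RInt_axis_gf n)) => x _.
  by rewrite /scal /= /mult /=; ring.
elim: N => [|N IHN].
  rewrite sum_O; apply: is_RInt_ext (term 0%N) => x _; by rewrite sum_O.
rewrite sum_Sn /plus /= Rmult_plus_distr_l.
apply: is_RInt_ext (is_RInt_plus _ _ _ _ _ _ IHN (term N.+1)) => x _.
by rewrite sum_Sn /plus /=; ring.
Qed.

Theorem proposition3p1 (z : R) (hz0 : 0 < z) (hz1 : z < 1 / 4) :
  let f := fun u : R =>
    (1 - 2 * u * z - sqrt ((1 - 2 * u * z) ^ 2 - 4 * z ^ 2)) / z ^ 2
    * sqrt (1 - u ^ 2) in
  ex_pseries (fun n : nat => INR (q 0 0 n)) z /\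
  ex_RInt f (-1) 1 /\
  Q00 z = 1 / PI * RInt f (-1) 1.
Proof.
move=> f.
have P0 := PI_RGT_0.
have csqrt g : (forall u : R, ex_derive g u) -> forall u : R, continuous (fun u => sqrt (g u)) u.
  move=> dg u; apply: (continuous_comp g); last exact: continuous_sqrt.
  exact: ex_derive_continuous.
have cf u : continuous f u.
  apply: continuous_mult; last by apply: csqrt => x; auto_derive.
  apply: (continuous_ext (fun u => mult (minus (1 - 2 * u * z)
      (sqrt ((1 - 2 * u * z) ^ 2 - 4 * z ^ 2))) (/ z ^ 2))) => [//|].
  apply: continuous_mult; last exact: continuous_const.
  apply: continuous_minus; last by apply: csqrt => x; auto_derive.
  by apply: ex_derive_continuous; auto_derive.
have exf : ex_RInt f (-1) 1 by apply: ex_RInt_continuous.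
pose a n := INR (q 0 0 n) * z ^ n.
(* Since [f / 2] is [(r/z) sqrt(1-u^2)], the remainder bound [(4z)^(N+1) / z] is integrated over an
   interval of length 2 and multiplied by [2 / PI]. *)
have rem N : Rabs (sum_n a N - 1 / PI * RInt f (-1) 1) <= 4 / (PI * z) * (4 * z) ^ N.+1.
  have If := is_RInt_scal _ _ _ (/ 2) _ (RInt_correct _ _ _ exf).
  have := is_RInt_minus _ _ _ _ _ _ (is_RInt_partial_sum z N) If.
  move/(norm_RInt_le_const _ (-1) 1 _ (/ z * (4 * z) ^ N.+1)) => bd.
  have {bd} : Rabs (PI / 2 * sum_n a N - / 2 * RInt f (-1) 1) <=
      (1 - -1) * (/ z * (4 * z) ^ N.+1).
    apply: bd => [|u hu]; first lra.
    have hr := axis_gf_remainder _ _ hz0 hz1 hu N.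
    set S := sum_n _ _ in hr *.
    change (Rabs (S * sqrt (1 - u ^ 2) - / 2 * f u) <= / z * (4 * z) ^ N.+1).
    have -> : S * sqrt (1 - u ^ 2) - / 2 * f u =
        (S - kernel_root z u / z) * sqrt (1 - u ^ 2).
      by rewrite /f /kernel_root; field; lra.
    rewrite Rabs_mult (Rabs_pos_eq (sqrt _)); last exact: sqrt_pos.
    have s1 : sqrt (1 - u ^ 2) <= 1.
      by rewrite -[X in _ <= X]sqrt_1; apply: sqrt_le_1_alt; nra.
    apply: Rle_trans hr; rewrite -[X in _ <= X]Rmult_1_r.
    by apply: Rmult_le_compat_l s1; exact: Rabs_pos.
  have -> : sum_n a N - 1 / PI * RInt f (-1) 1 =
      2 / PI * (PI / 2 * sum_n a N - / 2 * RInt f (-1) 1) by field; lra.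
  have p2 : 0 < 2 / PI by apply: Rdiv_lt_0_compat; lra.
  rewrite Rabs_mult (Rabs_pos_eq (2 / PI)); last lra.
  have -> : 4 / (PI * z) * (4 * z) ^ N.+1 = 2 / PI * ((1 - -1) * (/ z * (4 * z) ^ N.+1)).
    by field; lra.
  by apply: Rmult_le_compat_l; lra.
have lim0 : is_lim_seq (fun N => 4 / (PI * z) * (4 * z) ^ N.+1) 0.
  rewrite -(Rmult_0_r (4 / (PI * z))).
  apply: (is_lim_seq_scal_l (fun N => (4 * z) ^ N.+1) _ 0).
  apply/(is_lim_seq_incr_1 (fun N => (4 * z) ^ N) 0).
  by apply: is_lim_seq_geom; rewrite Rabs_pos_eq; lra.
have ser : is_pseries (fun n => INR (q 0 0 n)) z (1 / PI * RInt f (-1) 1).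
  apply/is_pseries_R; change (is_lim_seq (sum_n a) (1 / PI * RInt f (-1) 1)).
  have d0 : is_lim_seq (fun N => sum_n a N - 1 / PI * RInt f (-1) 1) 0.
    apply/is_lim_seq_abs_0; apply: is_lim_seq_le_le lim0; last exact: is_lim_seq_const.
    by move=> N; split; [exact: Rabs_pos | exact: rem].
  rewrite -[1 / PI * _ in X in is_lim_seq _ X]Rplus_0_l.
  apply: is_lim_seq_ext (is_lim_seq_plus' _ _ _ _ d0 (is_lim_seq_const (1 / PI * RInt f (-1) 1))).
  by move=> N; ring.
split; first by exists (1 / PI * RInt f (-1) 1).
by split; [|exact: is_pseries_unique].
Qed.
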